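(* Let $\mu$ be a non-trivial Nevanlinna measure on $\mathbb{R}^2$. Then $$\limsup_{R\to\infty}R^{-1}\mu(D(0,R))>0,$$ where $D(0,R):=\{t\in\mathbb{R}^2: |t_1|<R,\ |t_2|<R\}$.
   Context: A positive Borel measure $\mu$ on $\mathbb{R}^2$ is called a Nevanlinna measure if it satisfies the growth condition $\int_{\mathbb{R}^2}\frac{1}{(1+t_1^2)(1+t_2^2)}\,d\mu(t)<\infty$ and the Nevanlinna condition $$\int_{\mathbb{R}^2}\frac{1}{(t_1-z_1)^2(t_2-\overline{z_2})^2}\,d\mu(t)=0$$ for all $z=(z_1,z_2)\in(\mathbb{C}^+)^2$, where $\mathbb{C}^+=\{z\in\mathbb{C}:\operatorname{Im} z>0\}$. Non-trivial means not identically zero. *)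

(* Defs.v *)
From HB Require Import structures.
From mathcomp Require Import all_boot all_order all_algebra.
From mathcomp Require Import complex.
From mathcomp Require Import all_classical all_reals all_analysis.

Set Implicit Arguments.
Unset Strict Implicit.
Unset Printing Implicit Defensive.

Import Order.TTheory GRing.Theory Num.Theory.
Import numFieldNormedType.Exports.

Local Open Scope classical_set_scope.
Local Open Scope ring_scope.

Definition cintegral (d : measure_display) (T : measurableType d)
    (R : realType) (mu : {measure set T -> \bar R}) (D : set T) (f : T -> R[i]) : R[i] :=
  Complex (Rintegral mu D (fun t => complex.Re (f t)))
          (Rintegral mu D (fun t => complex.Im (f t))).

(* The product sigma-algebra on R * R is the Borel sigma-algebra of the plane,
   since R is second countable. *)
Definition growth_condition (R : realType)
    (mu : {measure set (R * R)%type -> \bar R}) : Prop :=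
  (\int[mu]_(t in setT)
     (((1 + t.1 ^+ 2) * (1 + t.2 ^+ 2))^-1)%:E < +oo)%E.

(* Under growth_condition the integrand below is mu-integrable, so the default
   values of Rintegral are never used. *)
Definition Nevanlinna_condition (R : realType)
    (mu : {measure set (R * R)%type -> \bar R}) : Prop :=
  forall z1 z2 : R[i], 0 < complex.Im z1 -> 0 < complex.Im z2 ->
    cintegral mu setT
      (fun t : R * R => ((real_complex R t.1 - z1) ^+ 2
                         * (real_complex R t.2 - conjc z2) ^+ 2)^-1) = 0.

Definition Nevanlinna_measure (R : realType)
    (mu : {measure set (R * R)%type -> \bar R}) : Prop :=
  growth_condition mu /\ Nevanlinna_condition mu.

(* A measure is a total function on sets, constrained only on measurable ones,
   hence the explicit measurability. *)
Definition nontrivial_measure (d : measure_display) (T : measurableType d)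
    (R : realType) (mu : {measure set T -> \bar R}) : Prop :=
  exists2 A : set T, measurable A & mu A <> 0%E.

Definition centered_square (R : realType) (r : R) : set (R * R) :=
  [set t | `|t.1| < r /\ `|t.2| < r].

(* Main.v *)
Require Import Defs.
From HB Require Import structures.
From mathcomp Require Import all_boot all_order all_algebra.
From mathcomp Require Import complex ring lra.
From mathcomp Require Import all_classical all_reals all_analysis measurable_realfun.

Set Implicit Arguments.
Unset Strict Implicit.
Unset Printing Implicit Defensive.

Import Order.TTheory GRing.Theory Num.Theory.
Import numFieldNormedType.Exports.
Local Open Scope classical_set_scope.
Local Open Scope ring_scope.

(** Write [w_y (t) = 1 / ((t1^2 + y^2) (t2^2 + y^2))].  Up to a constant,
    [y^2 * int w_y dmu] is the value at [i y] of the double Poisson integral of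
    [mu] restricted to the diagonal.  The Nevanlinna condition makes this
    restriction a positive harmonic function [u] on the upper half-plane, and
    Harnack's inequality says that [y * u (i y)] is nondecreasing in [y].  Hence
    [diag y = y^3 * int w_y dmu] stays above a positive constant as soon as [mu]
    is not zero ([diag_lower_bound]).  On the other hand the kernel
    [y^3 w_y (t)] is at most [y / (r^2 + y^2)] when [t] lies outside the square
    of half-side [r], so a bound [mu (D (0, r)) <= eps * r] for [r >= y] forces
    [diag y <= 8 * eps], by cutting the plane into dyadic shells
    ([integral_diag_kernel_le]).  The two bounds contradict each other if the
    upper limit is not positive.

    Harnack's inequality is obtained here without harmonic functions.  In the
    unimodular coordinates [A = (t1 + i y) / (t1 - i y)] and
    [B = (t2 - i y) / (t2 + i y)], the Nevanlinna condition says that the moments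
    [int w_y A^m B^n dmu] vanish for all [m, n >= 1] ([null_moment]); this follows
    from the double-pole identity by differentiating in the position of the two
    poles ([null_cauchyS]).  The infinitesimal form of Harnack's inequality is
    [int w_y (1 + Re A + Re B) dmu >= 0] ([integral_first_moments_ge0]).  It
    comes from the positivity of [int w_y |f|^2 dmu] where [f] is the sum of the
    monomials met along the staircase [1, A, A B, A (A B), ...], that is
    [f = (1 + A) (1 + A B + ... + (A B)^(n-1))]: a quotient of two of these
    monomials is [1], or [A] or [B] up to conjugation, or has a vanishing moment,
    so that this integral is [2 n int w_y (1 + Re A + Re B) dmu] up to a bounded
    term.

    The infinitesimal inequality is integrated along the integers: moving from
    [y] to [(1 + e) y] loses at most a factor [1 - 20 e^2] ([diag_step]), and
    with [y = n], [e = 1 / n] the product of these factors converges. *)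

(** * Complex-valued integrals *)

Local Notation normc := ComplexField.Normc.normc.

Section complex_modulus.
Context {R : realType}.
Implicit Types x y z : R[i].

Definition sqnormc z : R := complex.Re z ^+ 2 + complex.Im z ^+ 2.

Lemma normcE z : normc z = Num.sqrt (sqnormc z).
Proof. by case: z. Qed.

Lemma sqnormc_ge0 z : 0 <= sqnormc z.
Proof. by rewrite addr_ge0 ?sqr_ge0. Qed.

Lemma normc_ge0 z : 0 <= normc z.
Proof. by rewrite normcE sqrtr_ge0. Qed.

Lemma sqr_normcE z : normc z ^+ 2 = sqnormc z.
Proof. by rewrite normcE sqr_sqrtr ?sqnormc_ge0. Qed.

Lemma normcX z n : normc (z ^+ n) = normc z ^+ n.
Proof.
elim: n => [|n IH]; first by rewrite !expr0 ComplexField.Normc.normc1.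
by rewrite !exprS ComplexField.Normc.normcM IH.
Qed.

Lemma normc_real (r : R) : normc r%:C%C = `|r|.
Proof. by rewrite /= expr0n addr0 sqrtr_sqr. Qed.

Lemma abs_Re_le_normc z : `|complex.Re z| <= normc z.
Proof.
by rewrite normcE -sqrtr_sqr ler_sqrt ?sqnormc_ge0// lerDl sqr_ge0.
Qed.

Lemma abs_Im_le_normc z : `|complex.Im z| <= normc z.
Proof.
by rewrite normcE -sqrtr_sqr ler_sqrt ?sqnormc_ge0// lerDr sqr_ge0.
Qed.

Lemma normc_le_absD z : normc z <= `|complex.Re z| + `|complex.Im z|.
Proof.
rewrite normcE -[leRHS]ger0_norm ?addr_ge0// -sqrtr_sqr ler_wsqrtr//.
rewrite sqrrD !real_normK ?num_real// /sqnormc -addrA lerD2l lerDr.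
by rewrite mulrn_wge0// mulr_ge0.
Qed.

Lemma ReM x y : complex.Re (x * y) =
  complex.Re x * complex.Re y - complex.Im x * complex.Im y.
Proof. by case: x y => [a b] []. Qed.

Lemma ImM x y : complex.Im (x * y) =
  complex.Re x * complex.Im y + complex.Im x * complex.Re y.
Proof. by case: x y => [a b] []. Qed.

Lemma ReD x y : complex.Re (x + y) = complex.Re x + complex.Re y.
Proof. by case: x y => [a b] []. Qed.

Lemma ImD x y : complex.Im (x + y) = complex.Im x + complex.Im y.
Proof. by case: x y => [a b] []. Qed.

End complex_modulus.

Section complex_integral.
Context d (T : measurableType d) (R : realType).
Variable mu : {measure set T -> \bar R}.
Implicit Types (f g : T -> R[i]) (V : T -> R).

Definition cmeasurable f :=
  measurable_fun [set: T] (fun t => complex.Re (f t)) /\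
  measurable_fun [set: T] (fun t => complex.Im (f t)).

Definition cintegrable f :=
  mu.-integrable setT (EFin \o (fun t => complex.Re (f t))) /\
  mu.-integrable setT (EFin \o (fun t => complex.Im (f t))).

Lemma cmeasurable_cst (c : R[i]) : cmeasurable (fun=> c).
Proof. by split; exact: measurable_cst. Qed.

Lemma cmeasurableD f g :
  cmeasurable f -> cmeasurable g -> cmeasurable (fun t => f t + g t).
Proof.
move=> [f1 f2] [g1 g2]; split.
- by under eq_fun do rewrite ReD; exact: measurable_funD.
- by under eq_fun do rewrite ImD; exact: measurable_funD.
Qed.

Lemma cmeasurableM f g :
  cmeasurable f -> cmeasurable g -> cmeasurable (fun t => f t * g t).
Proof.
move=> [f1 f2] [g1 g2]; split.
- under eq_fun do rewrite ReM.
  by apply: measurable_funB; exact: measurable_funM.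
- under eq_fun do rewrite ImM.
  by apply: measurable_funD; exact: measurable_funM.
Qed.

Lemma cmeasurableX f n : cmeasurable f -> cmeasurable (fun t => f t ^+ n).
Proof.
move=> mf; elim: n => [|n IH]; first exact: cmeasurable_cst.
by under eq_fun do rewrite exprS; exact: cmeasurableM.
Qed.

Lemma measurable_sqnormc f :
  cmeasurable f -> measurable_fun [set: T] (fun t => sqnormc (f t)).
Proof.
by move=> [f1 f2]; apply: measurable_funD; exact: measurable_funX.
Qed.

Lemma integrable_dominated (h V : T -> R) : measurable_fun [set: T] h ->
  mu.-integrable setT (EFin \o V) -> (forall t, `|h t| <= V t) ->
  mu.-integrable setT (EFin \o h).
Proof.
move=> mh iV hV; apply: le_integrable iV => //; first exact/measurable_EFinP.
by move=> t _ /=; rewrite lee_fin (le_trans (hV t))// ler_norm.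
Qed.

Lemma cintegrable_dominated f V : cmeasurable f ->
  mu.-integrable setT (EFin \o V) -> (forall t, normc (f t) <= V t) ->
  cintegrable f.
Proof.
move=> [f1 f2] iV fV; split; apply: integrable_dominated iV _ => // t.
- exact: le_trans (abs_Re_le_normc _) (fV t).
- exact: le_trans (abs_Im_le_normc _) (fV t).
Qed.

Lemma integrableZl_fun (c : R) (h : T -> R) :
  mu.-integrable setT (EFin \o h) ->
  mu.-integrable setT (EFin \o (fun t => c * h t)).
Proof. by move=> ih; exact: (@integrableZl _ _ _ mu setT _ c (EFin \o h)). Qed.

Lemma integrableD_fun (h k : T -> R) :
  mu.-integrable setT (EFin \o h) -> mu.-integrable setT (EFin \o k) ->
  mu.-integrable setT (EFin \o (fun t => h t + k t)).
Proof.
by move=> ih ik; exact: (@integrableD _ _ _ mu setT _ (EFin \o h) (EFin \o k)).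
Qed.

Lemma integrableB_fun (h k : T -> R) :
  mu.-integrable setT (EFin \o h) -> mu.-integrable setT (EFin \o k) ->
  mu.-integrable setT (EFin \o (fun t => h t - k t)).
Proof.
by move=> ih ik; exact: (@integrableB _ _ _ mu setT _ (EFin \o h) (EFin \o k)).
Qed.

Lemma cintegrableD f g :
  cintegrable f -> cintegrable g -> cintegrable (fun t => f t + g t).
Proof.
move=> [f1 f2] [g1 g2]; split.
- under [X in EFin \o X]eq_fun do rewrite ReD; exact: integrableD_fun.
- under [X in EFin \o X]eq_fun do rewrite ImD; exact: integrableD_fun.
Qed.

Lemma cintegrableZl c f :
  cintegrable f -> cintegrable (fun t => c * f t).
Proof.
move=> [f1 f2]; split.
- under [X in EFin \o X]eq_fun do rewrite ReM.
  by apply: integrableB_fun; exact: integrableZl_fun.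
- under [X in EFin \o X]eq_fun do rewrite ImM.
  by apply: integrableD_fun; exact: integrableZl_fun.
Qed.

Lemma cintegralD f g : cintegrable f -> cintegrable g ->
  cintegral mu setT (fun t => f t + g t) =
  cintegral mu setT f + cintegral mu setT g.
Proof.
move=> [f1 f2] [g1 g2]; rewrite /cintegral.
under eq_Rintegral do rewrite ReD.
under [in X in Complex _ X]eq_Rintegral do rewrite ImD.
by rewrite !RintegralD.
Qed.

Lemma cintegralZl c f : cintegrable f ->
  cintegral mu setT (fun t => c * f t) = c * cintegral mu setT f.
Proof.
move=> [f1 f2]; rewrite /cintegral.
under eq_Rintegral do rewrite ReM.
under [in X in Complex _ X]eq_Rintegral do rewrite ImM.
rewrite RintegralB ?RintegralD ?RintegralZl//; try exact: integrableZl_fun.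
by case: c.
Qed.

(** The constant 2 comes from bounding the two parts separately; the sharp
    constant would be 1. *)
Lemma normc_cintegral_le f V : cintegrable f ->
  mu.-integrable setT (EFin \o V) -> (forall t, normc (f t) <= V t) ->
  normc (cintegral mu setT f) <= 2 * Rintegral mu setT V.
Proof.
move=> [f1 f2] iV fV; apply: le_trans (normc_le_absD _) _ => /=.
have le (h : T -> R) : mu.-integrable setT (EFin \o h) -> (forall t, `|h t| <= V t) ->
    `|Rintegral mu setT h| <= Rintegral mu setT V.
  move=> ih hV; apply: le_trans (le_normr_Rintegral _ ih) _ => //.
  apply: le_Rintegral => //.
  exact: (integrable_norm ih).
rewrite mulr_natl mulr2n; apply: lerD; apply: le => // t.
- exact: le_trans (abs_Re_le_normc _) (fV t).
- exact: le_trans (abs_Im_le_normc _) (fV t).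
Qed.

(** Integrability is part of the definition so that null functions can be added
    and scaled. *)
Definition null f := cintegrable f /\ cintegral mu setT f = 0.

Lemma nullD f g : null f -> null g -> null (fun t => f t + g t).
Proof.
move=> [f1 f2] [g1 g2]; split; first exact: cintegrableD.
by rewrite cintegralD// f2 g2 addr0.
Qed.

Lemma nullZl c f : null f -> null (fun t => c * f t).
Proof.
move=> [f1 f2]; split; first exact: cintegrableZl.
by rewrite cintegralZl// f2 mulr0.
Qed.

End complex_integral.

(** * Differentiation under the integral in the position of a pole *)

Section cauchy_kernel.
Context {R : realType}.
Implicit Types (x y : R) (z : R[i]).

(** Both signs of [y] are meant: the conjugate of [cauchy y x] is [cauchy (- y) x],
    so that one family covers poles in either half-plane. *)
Definition cauchy y x : R[i] := (Complex x (- y))^-1.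

Lemma cauchyE y x :
  cauchy y x = Complex (x / (x ^+ 2 + y ^+ 2)) (y / (x ^+ 2 + y ^+ 2)).
Proof. by rewrite /cauchy /GRing.inv /= sqrrN mulNr opprK. Qed.

Lemma sqr_normc_cauchy y x : normc (cauchy y x) ^+ 2 = (x ^+ 2 + y ^+ 2)^-1.
Proof.
rewrite ComplexField.Normc.normcV exprVn sqr_normcE /sqnormc /=.
by rewrite sqrrN.
Qed.

Lemma cauchy_pole_neq0 y x : y != 0 -> Complex x (- y) != 0.
Proof. by move=> y0; rewrite eq_complex /= oppr_eq0 (negbTE y0) andbF. Qed.

Lemma normc_cauchy_le y x : y != 0 -> normc (cauchy y x) <= `|y|^-1.
Proof.
move=> y0; have yp : 0 < `|y| by rewrite normr_gt0.
rewrite -ler_sqr ?nnegrE ?normc_ge0 ?invr_ge0 ?normr_ge0//.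
rewrite sqr_normc_cauchy exprVn real_normK ?num_real// lef_pV2 ?posrE.
- by rewrite lerDr sqr_ge0.
- by rewrite ltr_wpDl ?sqr_ge0// exprn_even_gt0.
- by rewrite exprn_even_gt0.
Qed.

Lemma measurable_inv_sqrDsqr y : y != 0 ->
  measurable_fun [set: R] (fun x : R => (x ^+ 2 + y ^+ 2)^-1).
Proof.
move=> y0; apply: continuous_measurable_fun => x.
apply: cvgV; first by rewrite gt_eqF// ltr_wpDl ?sqr_ge0// exprn_even_gt0.
by apply: cvgD; [exact: exprn_continuous|exact: cvg_cst].
Qed.

(** Second-order expansion of [(1 - z)^-m] at 0, with a remainder that is uniform
    on the disc of radius 1/2: this uniformity is what replaces dominated
    convergence in [null_cauchyS]. *)
Lemma binomial_remainder m : exists2 C : R, 0 <= C &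
  forall z, normc z <= 1 / 2 ->
    normc ((1 - z)^-1 ^+ m - 1 - m%:R * z) <= C * normc z ^+ 2.
Proof.
elim: m => [|m [C C0 IH]].
  exists 0 => // z _; rewrite expr0 subrr mul0r subrr.
  by rewrite ComplexField.Normc.normc0 mul0r.
exists (2 * C + m%:R + 2 * (1 + m%:R)) => [|z z2].
  by rewrite !addr_ge0 ?mulr_ge0 ?addr_ge0.
have n1 : 1 <= normc (1 - z) + normc z.
  rewrite -{1}(ComplexField.Normc.normc1 R) -{1}(subrK z 1).
  exact: le_normcD.
have z1 : 1 - z != 0.
  by apply/eqP => z1; move: n1; rewrite z1 ComplexField.Normc.normc0; lra.
set q := (1 - z)^-1; set p := q ^+ m.
have q2 : normc q <= 2.
  rewrite ComplexField.Normc.normcV -[leRHS]invrK lef_pV2 ?posrE; lra.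
have -> : q ^+ m.+1 - 1 - m.+1%:R * z =
    q * (p - 1 - m%:R * z) + z ^+ 2 * (m%:R + q * (1 + m%:R * z)).
  by rewrite exprS -/p /q -(natr1 m); field.
apply: le_trans (le_normcD _ _) _.
rewrite !ComplexField.Normc.normcM -expr2.
have mE : normc (m%:R : R[i]) = m%:R.
  by rewrite -(rmorph_nat (real_complex R)) normc_real ger0_norm.
have h1 := IH z z2; have zp := normc_ge0 z; have qp := normc_ge0 q.
have h2 : normc (m%:R + q * (1 + m%:R * z)) <= m%:R + 2 * (1 + m%:R).
  apply: le_trans (le_normcD _ _) _; rewrite mE lerD2l ComplexField.Normc.normcM.
  apply: ler_pM; rewrite ?normc_ge0//.
  apply: le_trans (le_normcD _ _) _.
  rewrite ComplexField.Normc.normc1 ComplexField.Normc.normcM mE lerD2l.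
  by rewrite ler_piMr//; lra.
have h3 : normc q * normc (p - 1 - m%:R * z) <= 2 * (C * normc z ^+ 2).
  by apply: ler_pM => //; exact: normc_ge0.
have h4 := ler_wpM2l (sqr_ge0 (normc z)) h2.
lra.
Qed.

End cauchy_kernel.

Section cauchy_derivative.
Context d (T : measurableType d) (R : realType).
Variable mu : {measure set T -> \bar R}.

Lemma cmeasurable_cauchy (pi : T -> R) (y : R) : y != 0 ->
  measurable_fun [set: T] pi -> cmeasurable (fun t => cauchy y (pi t)).
Proof.
move=> y0 mpi.
have mi : measurable_fun [set: T] (fun t => (pi t ^+ 2 + y ^+ 2)^-1).
  exact: measurableT_comp (measurable_inv_sqrDsqr y0) mpi.
split.
- by under eq_fun do rewrite cauchyE; exact: measurable_funM.
- under eq_fun do rewrite cauchyE; apply: measurable_funM => //.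
Qed.

(** Differentiation in [y]: the derivative of [(x - i y)^-m] is
    [i m (x - i y)^-(m+1)].  The pole is moved from [y] to [y (1 + h)] because then
    [cauchy (y (1 + h)) x = cauchy y x / (1 - i h y * cauchy y x)] and
    [|i h y * cauchy y x| <= h] uniformly in [x].  The sign [s] selects the
    half-line on which [y] varies, so that the lemma serves for both
    coordinates. *)
Lemma null_cauchyS (pi : T -> R) (g : T -> R[i]) (V : T -> R) (s : R) m :
  measurable_fun [set: T] pi -> cmeasurable g ->
  mu.-integrable setT (EFin \o V) -> (0 < m)%N ->
  (forall y, 0 < s * y -> exists C, forall t,
    normc (cauchy y (pi t) ^+ m * g t) <= C * V t) ->
  (forall y, 0 < s * y ->
    cintegral mu setT (fun t => cauchy y (pi t) ^+ m * g t) = 0) ->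
  forall y, 0 < s * y ->
    cintegral mu setT (fun t => cauchy y (pi t) ^+ m.+1 * g t) = 0.
Proof.
move=> mpi mg iV m0 bound vanish y sy.
have y0 : y != 0 by apply: contraTneq sy => ->; rewrite mulr0 ltxx.
have [C hC] := bound y sy.
have [K K0 hK] := @binomial_remainder R m.
have [D hD] : exists D, forall t,
    normc (cauchy y (pi t) ^+ m.+1 * g t) <= D * V t.
  exists (`|y|^-1 * C) => t; rewrite exprS -mulrA ComplexField.Normc.normcM -mulrA.
  by apply: ler_pM => //; rewrite ?normc_ge0 ?normc_cauchy_le.
have mc n z : z != 0 -> cmeasurable (fun t => cauchy z (pi t) ^+ n * g t).
  by move=> z0; apply: cmeasurableM => //; apply: cmeasurableX; exact: cmeasurable_cauchy.
have ic n z B : z != 0 -> (forall t, normc (cauchy z (pi t) ^+ n * g t) <= B * V t) ->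
    cintegrable mu (fun t => cauchy z (pi t) ^+ n * g t).
  by move=> z0; apply: cintegrable_dominated; [exact: mc|exact: integrableZl_fun].
set I := cintegral _ _ _; apply: ComplexField.Normc.eq0_normc.
(* The difference quotient of step h has integral 0; it differs from the
   derivative, whose integral is a multiple of I, by O(h). *)
have key h : 0 < h -> h <= 1 / 2 ->
    h * (m%:R * `|y| * normc I) <= h * (h * (2 * (K * C * Rintegral mu setT V))).
  move=> h0 h2.
  have sy' : 0 < s * (y * (1 + h)) by rewrite mulrA mulr_gt0//; lra.
  have y1 : y * (1 + h) != 0 by rewrite mulf_neq0//; lra.
  have [C' hC'] := bound _ sy'.
  pose X t : R[i] := Complex 0 (h * y) * cauchy y (pi t).
  have Xh t : normc (X t) <= h.
    rewrite ComplexField.Normc.normcM /= expr0n add0r sqrtr_sqr normrM.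
    rewrite (gtr0_norm h0) -mulrA ler_piMr ?(ltW h0)// -(mulfV (x := `|y|)) ?normr_eq0//.
    by rewrite ler_wpM2l// normc_cauchy_le.
  have shift t : cauchy (y * (1 + h)) (pi t) = cauchy y (pi t) * (1 - X t)^-1.
    have n0 := cauchy_pole_neq0 (pi t) y0.
    rewrite /X /cauchy -invfM; congr (_ ^-1).
    rewrite mulrBr mulr1 mulrCA mulfV// mulr1.
    by apply/eqP; rewrite eq_complex /=; apply/andP; split; apply/eqP; ring.
  pose c : R[i] := - (m%:R * Complex 0 (h * y)).
  pose F t := cauchy (y * (1 + h)) (pi t) ^+ m * g t +
    (- 1 * (cauchy y (pi t) ^+ m * g t) + c * (cauchy y (pi t) ^+ m.+1 * g t)).
  have FE t : F t = cauchy y (pi t) ^+ m * g t *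
      ((1 - X t)^-1 ^+ m - 1 - m%:R * X t).
    rewrite /F shift exprMn exprS; set q := (_ - _)^-1; rewrite /c /X.
    by move: (Complex 0 _) (cauchy _ _) q (m%:R) => a u q n; ring.
  have iF1 := ic _ _ _ y1 hC'; have iF2 := ic _ _ _ y0 hC; have iF3 := ic _ _ _ y0 hD.
  have IF : cintegral mu setT F = c * I.
    rewrite cintegralD//; last by apply: cintegrableD; exact: cintegrableZl.
    rewrite cintegralD//; try exact: cintegrableZl.
    by rewrite !cintegralZl// !vanish// mulr0 !add0r.
  have bF t : normc (F t) <= K * h ^+ 2 * C * V t.
    rewrite FE ComplexField.Normc.normcM mulrC -mulrA.
    apply: ler_pM; rewrite ?normc_ge0//.
    apply: le_trans (hK _ _) _; first exact: le_trans (Xh t) h2.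
    rewrite ler_wpM2l// ler_sqr ?nnegrE ?normc_ge0//; lra.
  have := @normc_cintegral_le _ _ _ mu F _ _ _ bF.
  rewrite IF ComplexField.Normc.normcM /c normcN ComplexField.Normc.normcM.
  rewrite -(rmorph_nat (real_complex R)) normc_real /= expr0n add0r sqrtr_sqr.
  rewrite normrM.
  rewrite (ger0_norm (ler0n _ _)) (gtr0_norm h0) RintegralZl//.
  move=> /(_ _ _)/le_trans => H.
  rewrite -!mulrA mulrCA !mulrA -(mulrA m%:R).
  apply: H.
  - apply: cintegrableD => //; apply: cintegrableD; exact: cintegrableZl.
  - exact: integrableZl_fun.
  - by rewrite le_eqVlt; apply/orP; left; apply/eqP; ring.
(* Dividing by h and letting h tend to 0 kills I. *)
set M := 2 * _ in key; set N := m%:R * _ * _ in key.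
have NI : 0 <= N by rewrite !mulr_ge0 ?normc_ge0.
have N0 : N <= 0.
  apply/ler_addgt0Pl => e e0; rewrite addr0.
  pose h := Num.min (1 / 2) (e / (`|M| + 1)).
  have M1 : 0 < `|M| + 1 by rewrite ltr_wpDl.
  have h0 : 0 < h by rewrite lt_min; apply/andP; split; [lra|exact: divr_gt0].
  have := key h h0; rewrite ge_min lexx ler_pM2l// => /(_ erefl) /le_trans; apply.
  apply: le_trans (_ : h * (`|M| + 1) <= _).
    by rewrite ler_pM2l//; have := ler_norm M; lra.
  by rewrite -ler_pdivlMr// ge_min lexx orbT.
have /eqP : N = 0 by apply/eqP; rewrite eq_le N0.
by rewrite !mulf_eq0 pnatr_eq0 normr_eq0 (negbTE y0) eqn0Ngt m0 => /eqP.
Qed.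

End cauchy_derivative.

(** * Vanishing of the mixed moments *)

Section kernel_bounds.
Context {R : realType}.
Implicit Types (x y : R) (t : R * R).

Definition growth_weight t : R := ((1 + t.1 ^+ 2) * (1 + t.2 ^+ 2))^-1.

Definition weight y t : R := ((t.1 ^+ 2 + y ^+ 2) * (t.2 ^+ 2 + y ^+ 2))^-1.

(** The Blaschke factor [(x + i y) / (x - i y)], in the form that expands into
    powers of the Cauchy kernel.  At [- y] it is the conjugate factor. *)
Definition blaschke y x : R[i] := 1 + Complex 0 (2 * y) * cauchy y x.

Lemma sqrDsqr_gt0 y x : y != 0 -> 0 < x ^+ 2 + y ^+ 2.
Proof. by move=> y0; rewrite ltr_wpDl ?sqr_ge0// exprn_even_gt0. Qed.

Lemma inv_sqrDsqr_le y x : y != 0 ->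
  (x ^+ 2 + y ^+ 2)^-1 <= (1 + y ^- 2) * (1 + x ^+ 2)^-1.
Proof.
move=> y0; have x1 : 0 < 1 + x ^+ 2 by rewrite ltr_pwDl ?sqr_ge0.
rewrite ler_pdivlMr// mulrC ler_pdivrMr ?sqrDsqr_gt0//.
have := sqr_ge0 x; have y2 : 0 <= y ^- 2 * x ^+ 2 by rewrite mulr_ge0 ?invr_ge0 ?sqr_ge0.
have yy : y ^- 2 * y ^+ 2 = 1 by rewrite mulVf// expf_neq0.
have := sqr_ge0 y; nra.
Qed.

Lemma normc_cauchyX_le y n : y != 0 -> exists2 C : R, 0 <= C &
  forall x, normc (cauchy y x ^+ n.+2) <= C * (1 + x ^+ 2)^-1.
Proof.
move=> y0; exists (`|y|^-1 ^+ n * (1 + y ^- 2)) => [|x].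
  by rewrite mulr_ge0 ?exprn_ge0 ?addr_ge0 ?invr_ge0 ?sqr_ge0.
rewrite -addn2 exprD ComplexField.Normc.normcM 2!normcX sqr_normc_cauchy -mulrA.
apply: ler_pM; rewrite ?exprn_ge0 ?normc_ge0 ?invr_ge0 ?(ltW (sqrDsqr_gt0 _ _))//.
- by rewrite lerXn2r ?nnegrE ?normc_ge0 ?invr_ge0 ?normc_cauchy_le.
- exact: inv_sqrDsqr_le.
Qed.

Lemma weight_le y t : y != 0 ->
  weight y t <= (1 + y ^- 2) ^+ 2 * growth_weight t.
Proof.
move=> y0; rewrite /weight /growth_weight (expr2 (1 + y ^- 2)).
rewrite (invfM (_ + y ^+ 2)) (invfM (1 + _)) mulrACA.
by apply: ler_pM; rewrite ?inv_sqrDsqr_le ?invr_ge0 ?(ltW (sqrDsqr_gt0 _ _)).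
Qed.

Lemma weight_gt0 y t : y != 0 -> 0 < weight y t.
Proof. by move=> y0; rewrite invr_gt0 mulr_gt0 ?sqrDsqr_gt0. Qed.

Lemma measurable_weight y : y != 0 -> measurable_fun setT (weight y).
Proof.
move=> y0; rewrite /weight; under eq_fun do rewrite invfM.
apply: measurable_funM.
- exact: measurableT_comp (measurable_inv_sqrDsqr y0) measurable_fst.
- exact: measurableT_comp (measurable_inv_sqrDsqr y0) measurable_snd.
Qed.

Lemma cauchyMN y x : (cauchy y x) * (cauchy (- y) x) = (x ^+ 2 + y ^+ 2)^-1%:C%C.
Proof.
rewrite /cauchy opprK -invfM fmorphV; congr (_ ^-1).
by apply/eqP; rewrite eq_complex /=; apply/andP; split; apply/eqP; ring.
Qed.

Lemma weight_cauchy y t : (weight y t)%:C%C =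
  cauchy y t.1 * cauchy (- y) t.1 * (cauchy y t.2 * cauchy (- y) t.2).
Proof. by rewrite !cauchyMN /weight invfM rmorphM. Qed.

Lemma cauchyN_blaschke y x : y != 0 -> cauchy (- y) x * blaschke y x = cauchy y x.
Proof.
move=> y0; rewrite /blaschke {1}/cauchy opprK mulrDr mulr1 mulrCA.
have n0 := cauchy_pole_neq0 x y0.
have n1 : Complex x y != 0.
  by rewrite eq_complex /= (negbTE y0) andbF.
have : Complex x y - Complex x (- y) = Complex 0 (2 * y).
  by apply/eqP; rewrite eq_complex /=; apply/andP; split; apply/eqP; ring.
rewrite /cauchy; move: n0 n1; move: (Complex x _) (Complex x _) (Complex 0 _).
by move=> a b c a0 b0 <-; field; apply/andP.
Qed.

Lemma blaschkeM y x z :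
  blaschke y x * z = z + Complex 0 (2 * y) * (cauchy y x * z).
Proof. by rewrite mulrDl mul1r mulrA. Qed.

Lemma Re_blaschke y x :
  complex.Re (blaschke y x) = 1 - 2 * (y ^+ 2 / (x ^+ 2 + y ^+ 2)).
Proof. by rewrite /blaschke cauchyE /=; ring. Qed.

Lemma Im_blaschke y x :
  complex.Im (blaschke y x) = 2 * (x * y / (x ^+ 2 + y ^+ 2)).
Proof. by rewrite /blaschke cauchyE /=; ring. Qed.

Lemma sqnormc_blaschke y x : y != 0 -> sqnormc (blaschke y x) = 1.
Proof.
move=> y0; rewrite /sqnormc Re_blaschke Im_blaschke.
by field; rewrite gt_eqF// sqrDsqr_gt0.
Qed.

Lemma blaschkeMconj y x : y != 0 -> conjc (blaschke y x) * blaschke y x = 1.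
Proof.
move=> y0; have := sqnormc_blaschke x y0; case: (blaschke y x) => a b.
rewrite /sqnormc /= => h; apply/eqP; rewrite eq_complex /=.
by apply/andP; split; apply/eqP; [rewrite -h|]; ring.
Qed.

End kernel_bounds.

Section vanishing_moments.
Context {R : realType}.
Variable mu : {measure set (R * R)%type -> \bar R}.
Hypothesis mu_nevanlinna : Nevanlinna_measure mu.

Lemma integrable_growth_weight : mu.-integrable setT (EFin \o growth_weight).
Proof.
case: mu_nevanlinna => g _.
have w0 (t : R * R) : 0 <= growth_weight t.
  by rewrite invr_ge0 mulr_ge0 ?addr_ge0 ?sqr_ge0.
apply/integrableP; split.
  apply/measurable_EFinP; have := measurable_weight (oner_neq0 R).
  rewrite /weight expr1n; congr measurable_fun; apply/funext => t.
  by rewrite /growth_weight !(addrC 1).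
rewrite (eq_integral (fun t => (growth_weight t)%:E))// => t _ /=.
by rewrite ger0_norm.
Qed.

Lemma integrable_weight y : y != 0 -> mu.-integrable setT (EFin \o weight y).
Proof.
move=> y0; apply: (integrable_dominated (measurable_weight y0)
  (integrableZl_fun ((1 + y ^- 2) ^+ 2) integrable_growth_weight)) => t.
by rewrite (gtr0_norm (weight_gt0 _ y0)) weight_le.
Qed.

Lemma normc_cauchy_pair_le y1 y2 m n : y1 != 0 -> y2 != 0 -> exists C : R,
  forall t : R * R, normc (cauchy y1 t.1 ^+ m.+2 * cauchy y2 t.2 ^+ n.+2) <=
    C * growth_weight t.
Proof.
move=> /(@normc_cauchyX_le R _ m)[C C0 hC] /(@normc_cauchyX_le R _ n)[D D0 hD].
exists (C * D) => t; rewrite ComplexField.Normc.normcM /growth_weight invfM mulrACA.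
by apply: ler_pM; rewrite ?normc_ge0.
Qed.

Lemma cmeasurable_cauchy1 y m : y != 0 ->
  cmeasurable (fun t : R * R => cauchy y t.1 ^+ m).
Proof.
by move=> y0; apply/cmeasurableX/cmeasurable_cauchy => //; exact: measurable_fst.
Qed.

Lemma cmeasurable_cauchy2 y m : y != 0 ->
  cmeasurable (fun t : R * R => cauchy y t.2 ^+ m).
Proof.
by move=> y0; apply/cmeasurableX/cmeasurable_cauchy => //; exact: measurable_snd.
Qed.

(** The case [m = n = 0] is the Nevanlinna condition at [(i y1, - i y2)]; the
    higher poles come by differentiating, in the first coordinate and then in the
    second. *)
Lemma cintegral_cauchy_pair y1 y2 m n : 0 < y1 -> y2 < 0 ->
  cintegral mu setT (fun t => cauchy y1 t.1 ^+ m.+2 * cauchy y2 t.2 ^+ n.+2) = 0.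
Proof.
have iW := integrable_growth_weight.
elim: n y1 y2 => [|n IHn] y1 y2 y10 y20.
- elim: m y1 y10 => [|m IHm] y1 y10.
    case: mu_nevanlinna => _ /(_ (Complex 0 y1) (Complex 0 (- y2))) /= <- //.
      congr cintegral; apply/funext => t; rewrite /cauchy !exprVn -invfM.
      congr ((_ ^+ 2 * _ ^+ 2)^-1).
      + by apply/eqP; rewrite eq_complex /= subr0 sub0r !eqxx.
      + by apply/eqP; rewrite eq_complex /= subr0 sub0r opprK !eqxx.
    by rewrite oppr_gt0.
  apply: (@null_cauchyS _ _ _ mu fst _ growth_weight 1); rewrite ?mul1r//.
  + exact: cmeasurable_cauchy2 _ (ltr0_neq0 y20).
  + move=> y; rewrite mul1r => y0.
    by apply: normc_cauchy_pair_le; [rewrite gt_eqF|rewrite lt_eqF].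
  + by move=> y; rewrite mul1r; exact: IHm.
- under eq_fun do rewrite mulrC.
  apply: (@null_cauchyS _ _ _ mu snd _ growth_weight (-1)); rewrite ?mulN1r ?oppr_gt0//.
  + by apply: cmeasurable_cauchy1; rewrite gt_eqF.
  + move=> y; rewrite mulN1r oppr_gt0 => y0.
    have [C hC] := @normc_cauchy_pair_le y1 y m n (lt0r_neq0 y10) (ltr0_neq0 y0).
    by exists C => t; rewrite mulrC.
  + move=> y; rewrite mulN1r oppr_gt0 => y0; rewrite -[RHS](IHn y1 y)//.
    by under eq_fun do rewrite mulrC.
Qed.

Lemma null_cauchy_pair y1 y2 m n : 0 < y1 -> y2 < 0 ->
  null mu (fun t => cauchy y1 t.1 ^+ m.+2 * cauchy y2 t.2 ^+ n.+2).
Proof.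
move=> y10 y20; split; last exact: cintegral_cauchy_pair.
have y11 : y1 != 0 by rewrite gt_eqF.
have y21 : y2 != 0 by rewrite lt_eqF.
have [C hC] := @normc_cauchy_pair_le y1 y2 m n y11 y21.
apply: cintegrable_dominated hC.
- by apply: cmeasurableM; [exact: cmeasurable_cauchy1|exact: cmeasurable_cauchy2].
- exact: integrableZl_fun integrable_growth_weight.
Qed.

(** Expanding the Blaschke factors in powers of the Cauchy kernels leaves products
    of poles of order at least 2. *)
Lemma null_cauchy_blaschke y m n k l : 0 < y ->
  null mu (fun t => (cauchy y t.1 ^+ m.+2 * blaschke y t.1 ^+ k) *
                    (cauchy (- y) t.2 ^+ n.+2 * blaschke (- y) t.2 ^+ l)).
Proof.
move=> y0; elim: k m l n => [|k IHk] m l n.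
- elim: l n => [|l IHl] n.
    under eq_fun do rewrite !expr0 !mulr1.
    by apply: null_cauchy_pair; rewrite ?oppr_lt0.
  have := nullD (IHl n) (nullZl (Complex 0 (2 * - y)) (IHl n.+1)).
  congr null; apply/funext => t; rewrite (exprS _ l) blaschkeM.
  by rewrite (exprS (cauchy (- y) _) n.+2); ring.
- have := nullD (IHk m l n) (nullZl (Complex 0 (2 * y)) (IHk m.+1 l n)).
  congr null; apply/funext => t; rewrite (exprS _ k) blaschkeM.
  by rewrite (exprS (cauchy y _) m.+2); ring.
Qed.

(** Since [w_y * A * B] is the product of the two double-pole Cauchy kernels, this
    is the case [m = n = 0] of [null_cauchy_blaschke]. *)
Lemma null_moment y m n : 0 < y ->
  null mu (fun t => (weight y t)%:C%C *
                    (blaschke y t.1 ^+ m.+1 * blaschke (- y) t.2 ^+ n.+1)).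
Proof.
move=> y0; have y1 : y != 0 by rewrite gt_eqF.
have := @null_cauchy_blaschke y 0 0 m n y0; congr null; apply/funext => t.
have Ny1 : - y != 0 by rewrite oppr_eq0.
rewrite weight_cauchy.
have := cauchyN_blaschke t.1 y1; have := cauchyN_blaschke t.2 Ny1; rewrite opprK.
rewrite !exprS; move: (cauchy y t.1) (cauchy (- y) t.1) (cauchy y t.2) (cauchy (- y) t.2).
move: (blaschke _ _) (blaschke _ _) => b a u u' v v' <- <-; rewrite expr0 !mulr1.
by ring.
Qed.

End vanishing_moments.

(** * Positivity along staircases of monomials *)

Section toeplitz_positivity.
Context {R : realType}.
Variable mu : {measure set (R * R)%type -> \bar R}.
Hypothesis mu_nevanlinna : Nevanlinna_measure mu.
Implicit Types y : R.

Lemma sqnormcM (x z : R[i]) : sqnormc (x * z) = sqnormc x * sqnormc z.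
Proof. by rewrite /sqnormc ReM ImM; ring. Qed.

Lemma sqnormc1D (z : R[i]) : sqnormc (1 + z) = 1 + 2 * complex.Re z + sqnormc z.
Proof. by rewrite /sqnormc ReD ImD /=; ring. Qed.

Lemma Re_scale (r : R) (z : R[i]) : complex.Re (r%:C%C * z) = r * complex.Re z.
Proof. by rewrite ReM /= mul0r subr0. Qed.

(** The geometric sum whose product with [1 + A] is the staircase sum: the
    exponents of [A] and of the conjugate of [B] in its terms form an
    antichain. *)
Definition antichain_sum y n (t : R * R) : R[i] :=
  \sum_(k < n) (blaschke y t.1 * blaschke (- y) t.2) ^+ k.

Definition antichain_square y n (t : R * R) : R :=
  weight y t * (sqnormc (1 + blaschke y t.1) * sqnormc (antichain_sum y n t)).

Definition first_moments y (t : R * R) : R :=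
  weight y t * (1 + complex.Re (blaschke y t.1) + complex.Re (blaschke (- y) t.2)).

Lemma antichain_sumS y n t : antichain_sum y n.+1 t =
  1 + blaschke y t.1 * blaschke (- y) t.2 * antichain_sum y n t.
Proof.
rewrite /antichain_sum big_ord_recl expr0 mulr_sumr.
by congr (_ + _); apply: eq_bigr => k _; rewrite -exprS.
Qed.

(** For unimodular [c], [|1 + c S|^2 = |S|^2 + 1 + 2 Re (c S)]. *)
Lemma antichain_squareS y n t : y != 0 ->
  antichain_square y n.+1 t = antichain_square y n t + weight y t *
    (sqnormc (1 + blaschke y t.1) * (1 + 2 * complex.Re
      (blaschke y t.1 * blaschke (- y) t.2 * antichain_sum y n t))).
Proof.
move=> y0; have Ny0 : - y != 0 by rewrite oppr_eq0.
rewrite /antichain_square antichain_sumS (sqnormc1D (_ * _ * _)).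
rewrite (sqnormcM (_ * _)) (sqnormcM (blaschke _ _)).
by rewrite !sqnormc_blaschke//; ring.
Qed.

(** In the expansion of [|1 + A|^2 (c + c^2 + ... )] with [c = A B], the only
    monomial outside the vanishing quadrant is [conj A * A * B = B]. *)
Lemma antichain_remainder y n : 0 < y -> exists2 Z : R * R -> R[i], null mu Z &
  forall t, (weight y t)%:C%C * ((2 + blaschke y t.1 + conjc (blaschke y t.1)) *
    (blaschke y t.1 * blaschke (- y) t.2 * antichain_sum y n.+1 t)) =
  (weight y t)%:C%C * blaschke (- y) t.2 + Z t.
Proof.
move=> y0; have y1 : y != 0 by rewrite gt_eqF.
have M i j := null_moment mu_nevanlinna i j y0.
elim: n => [|n [Z nZ ZE]].
- exists (fun t => 2 * ((weight y t)%:C%C *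
      (blaschke y t.1 ^+ 1 * blaschke (- y) t.2 ^+ 1)) +
    (weight y t)%:C%C * (blaschke y t.1 ^+ 2 * blaschke (- y) t.2 ^+ 1)).
    exact: nullD (nullZl _ (M _ _)) (M _ _).
  move=> t; rewrite /antichain_sum big_ord1 !expr1 expr0.
  have := blaschkeMconj t.1 y1.
  move: (blaschke y _) (blaschke (- y) _) (conjc _) (_%:C%C) => a b a' w aa.
  rewrite [LHS](_ : _ = w * (a' * a) * b + (2 * (w * (a * b)) + w * (a ^+ 2 * b))).
    by rewrite aa mulr1.
  by ring.
- exists (fun t => Z t + (2 * ((weight y t)%:C%C *
      (blaschke y t.1 ^+ n.+2 * blaschke (- y) t.2 ^+ n.+2)) +
    ((weight y t)%:C%C * (blaschke y t.1 ^+ n.+3 * blaschke (- y) t.2 ^+ n.+2) +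
     (weight y t)%:C%C * (blaschke y t.1 ^+ n.+1 * blaschke (- y) t.2 ^+ n.+2)))).
    exact: nullD nZ (nullD (nullZl _ (M _ _)) (nullD (M _ _) (M _ _))).
  move=> t; cbv beta; rewrite [RHS]addrA -ZE.
  rewrite (_ : antichain_sum y n.+2 t = antichain_sum y n.+1 t +
    (blaschke y t.1 * blaschke (- y) t.2) ^+ n.+1); last first.
    by rewrite /antichain_sum big_ord_recr.
  have := blaschkeMconj t.1 y1.
  move: (antichain_sum _ _ _) (blaschke y _) (blaschke (- y) _) (conjc _) (_%:C%C).
  move=> S a b a' w aa; rewrite exprMn !exprS.
  set X := a ^+ n; set Y := b ^+ n.
  rewrite [LHS](_ : _ = w * ((2 + a + a') * (a * b * S)) +
    (2 * (w * (a * (a * X) * (b * (b * Y)))) + (w * (a * (a * (a * X)) * (b * (b * Y))) +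
    w * ((a' * a) * (a * X) * (b * (b * Y)))))); last by ring.
  by rewrite aa mul1r.
Qed.

Lemma first_moments_bound y t : y != 0 -> `|first_moments y t| <= 3 * weight y t.
Proof.
move=> y0; have Ny0 : - y != 0 by rewrite oppr_eq0.
rewrite normrM (gtr0_norm (weight_gt0 t y0)) mulrC ler_pM2r ?weight_gt0//.
have n1 (z x : R) : z != 0 -> `|complex.Re (blaschke z x)| <= 1.
  move=> z0; apply: le_trans (abs_Re_le_normc _) _.
  by rewrite normcE sqnormc_blaschke// sqrtr1.
apply: le_trans (ler_normD _ _) _.
have := ler_normD 1 (complex.Re (blaschke y t.1)); rewrite normr1.
have := n1 y t.1 y0; have := n1 (- y) t.2 Ny0; lra.
Qed.

Lemma measurable_first_moments y : y != 0 ->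
  measurable_fun [set: R * R] (first_moments y).
Proof.
move=> y0; have Ny0 : - y != 0 by rewrite oppr_eq0.
apply: measurable_funM; first exact: measurable_weight.
have mb (z : R) (pi : R * R -> R) : z != 0 -> measurable_fun setT pi ->
    cmeasurable (fun t => blaschke z (pi t)).
  move=> z0 mpi; apply: cmeasurableD; first exact: cmeasurable_cst.
  by apply: cmeasurableM; [exact: cmeasurable_cst|exact: cmeasurable_cauchy].
apply: measurable_funD; last exact: (mb _ _ Ny0 measurable_snd).1.
apply: measurable_funD; first exact: measurable_cst.
exact: (mb _ _ y0 measurable_fst).1.
Qed.

Lemma integrable_first_moments y : y != 0 ->
  mu.-integrable setT (EFin \o first_moments y).
Proof.
move=> y0; apply: (integrable_dominated (measurable_first_moments y0)
  (integrableZl_fun 3 (integrable_weight mu_nevanlinna y0))) => t.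
exact: first_moments_bound.
Qed.

(** Each new step of the staircase contributes the same amount, because the terms
    that would distinguish the steps have vanishing moments. *)
Lemma integral_antichain_square y n : 0 < y ->
  mu.-integrable setT (EFin \o antichain_square y n.+1) /\
  Rintegral mu setT (antichain_square y n.+1) =
    Rintegral mu setT (antichain_square y 1) +
    2 * n%:R * Rintegral mu setT (first_moments y).
Proof.
move=> y0; have y1 : y != 0 by rewrite gt_eqF.
have Ny1 : - y != 0 by rewrite oppr_eq0.
have iq := integrable_first_moments y1.
have mb : cmeasurable (fun t : R * R => blaschke y t.1).
  apply: cmeasurableD; first exact: cmeasurable_cst.
  apply: cmeasurableM; first exact: cmeasurable_cst.
  by apply: cmeasurable_cauchy => //; exact: measurable_fst.
have F1 : antichain_square y 1 = fun t => weight y t * sqnormc (1 + blaschke y t.1).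
  apply/funext => t; rewrite /antichain_square /antichain_sum big_ord1 expr0.
  by rewrite /sqnormc /= expr1n expr0n addr0 mulr1.
elim: n => [|n [iF IF]].
- split; last by rewrite mulr0 mul0r addr0.
  apply: integrable_dominated (integrableZl_fun 4 (integrable_weight mu_nevanlinna y1)) _.
    rewrite F1; apply: measurable_funM; first exact: measurable_weight.
    by apply: measurable_sqnormc; apply: cmeasurableD => //; exact: cmeasurable_cst.
  move=> t; rewrite F1.
  rewrite ger0_norm; last by rewrite mulr_ge0 ?sqnormc_ge0// ltW// weight_gt0.
  rewrite mulrC ler_pM2r ?weight_gt0// sqnormc1D sqnormc_blaschke//.
  have := abs_Re_le_normc (blaschke y t.1); rewrite normcE sqnormc_blaschke// sqrtr1.
  by rewrite ler_norml; lra.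
- have [Z [[iZ _] Z0] ZE] := @antichain_remainder y n y0.
  have FE : antichain_square y n.+2 = fun t => antichain_square y n.+1 t +
      (2 * first_moments y t + 2 * complex.Re (Z t)).
    apply/funext => t; rewrite antichain_squareS//; congr (_ + _).
    have := congr1 (@complex.Re R) (ZE t); rewrite ReD.
    rewrite (_ : 2 + _ + _ = (sqnormc (1 + blaschke y t.1))%:C%C); last first.
      have := sqnormc_blaschke t.1 y1; rewrite sqnormc1D => ->.
      by case: (blaschke y _) => a b; apply/eqP; rewrite eq_complex /=;
        apply/andP; split; apply/eqP; ring.
    rewrite !Re_scale /first_moments => h.
    have : weight y t * sqnormc (1 + blaschke y t.1) =
        weight y t * (2 + 2 * complex.Re (blaschke y t.1)).
      by rewrite sqnormc1D sqnormc_blaschke//; ring.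
    lra.
  have iS : mu.-integrable setT (EFin \o
      (fun t => 2 * first_moments y t + 2 * complex.Re (Z t))).
    by apply: integrableD_fun; exact: integrableZl_fun.
  split; first by rewrite FE; exact: integrableD_fun.
  have Z1 : Rintegral mu setT (fun t => complex.Re (Z t)) = 0 by case: Z0.
  rewrite FE RintegralD// RintegralD//; try exact: integrableZl_fun.
  rewrite !RintegralZl// Z1 IF -natr1; ring.
Qed.

(** A nonnegative sequence that is affine in [n] has a nonnegative slope. *)
Lemma integral_first_moments_ge0 y : 0 < y ->
  0 <= Rintegral mu setT (first_moments y).
Proof.
move=> y0; have y1 : y != 0 by rewrite gt_eqF.
rewrite leNgt; apply/negP; set q := Rintegral _ _ _ => q0.
pose p := Rintegral mu setT (antichain_square y 1).
have pos n : 0 <= Rintegral mu setT (antichain_square y n.+1).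
  apply: Rintegral_ge0 => t _; rewrite !mulr_ge0 ?sqnormc_ge0//.
  exact: ltW (weight_gt0 _ y1).
have q1 : 0 < - (2 * q) by lra.
have := archi_boundP (divr_ge0 (pos 0) (ltW q1)).
set N := Num.bound _; rewrite ltr_pdivrMr// => h.
have := pos N; rewrite (integral_antichain_square N y0).2 -/q; lra.
Qed.

End toeplitz_positivity.

(** * Growth of the diagonal Poisson integral *)

Section growth_of_diagonal.
Context {R : realType}.
Variable mu : {measure set (R * R)%type -> \bar R}.
Hypothesis mu_nevanlinna : Nevanlinna_measure mu.
Implicit Types y : R.

Definition diag_kernel y (t : R * R) : R := y ^+ 3 * weight y t.

Definition diag y : R := Rintegral mu setT (diag_kernel y).

Lemma integrable_diag_kernel y : y != 0 ->
  mu.-integrable setT (EFin \o diag_kernel y).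
Proof.
by move=> y0; exact: (integrableZl_fun (y ^+ 3) (integrable_weight mu_nevanlinna y0)).
Qed.

Lemma diag_kernel_gt0 y t : 0 < y -> 0 < diag_kernel y t.
Proof.
by move=> y0; rewrite mulr_gt0 ?exprn_gt0// weight_gt0// gt_eqF.
Qed.

(** With [x = y^2 / (t1^2 + y^2)] and [x' = y^2 / (t2^2 + y^2)], the right-hand side
    is the ratio of the kernels at [(1 + e) y] and at [y], and [3 - 2 x - 2 x'] is
    both its logarithmic derivative at [e = 0] and the value of [1 + Re A + Re B]. *)
Lemma harnack_factor_ge (e x x' : R) : 0 <= e -> e <= 1 / 5 ->
  0 <= x <= 1 -> 0 <= x' <= 1 ->
  1 - 20 * e ^+ 2 + e * (3 - 2 * x - 2 * x') <=
  (1 + e) ^+ 3 / ((1 + (2 * e + e ^+ 2) * x) * (1 + (2 * e + e ^+ 2) * x')).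
Proof.
move=> e0 e5 /andP[x0 x1] /andP[x'0 x'1]; set s := 2 * e + e ^+ 2.
have s0 : 0 <= s by rewrite /s; nra.
have s1 : s <= 44 / 100 by rewrite /s; nra.
have inv1 z : 0 <= z <= 1 -> 0 <= 1 - s * z <= (1 + s * z)^-1.
  move=> /andP[z0 z1]; have sz : 0 <= s * z by rewrite mulr_ge0.
  apply/andP; split; first by nra.
  by rewrite -div1r ler_pdivlMr; nra.
have /andP[a0 a1] := inv1 x (introT andP (conj x0 x1)).
have /andP[b0 b1] := inv1 x' (introT andP (conj x'0 x'1)).
have ab : 1 - s * (x + x') <= ((1 + s * x) * (1 + s * x'))^-1.
  rewrite invfM; apply: le_trans (ler_pM a0 b0 a1 b1).
  have : 0 <= (s * x) * (s * x') by rewrite !mulr_ge0.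
  by nra.
have c0 : 0 <= (1 + e) ^+ 3 by rewrite exprn_ge0//; lra.
apply: le_trans (ler_wpM2l c0 ab).
set p := x + x'; have p0 : 0 <= p by rewrite addr_ge0.
have p2 : p <= 2 by rewrite /p; lra.
have sp : 0 <= 1 - s * p by nra.
have c1 : 1 + 3 * e <= (1 + e) ^+ 3.
  have : 0 <= e ^+ 2 * (3 + e) by rewrite mulr_ge0 ?sqr_ge0//; lra.
  by rewrite !exprS expr0; nra.
apply: le_trans (ler_wpM2r sp c1).
rewrite -subr_ge0 (_ : _ - _ = e ^+ 2 * (20 - 7 * p - 3 * e * p)); last first.
  by rewrite /s /p; ring.
by rewrite mulr_ge0 ?sqr_ge0//; nra.
Qed.

Lemma diag_kernel_step y e t : 0 < y -> 0 <= e -> e <= 1 / 5 ->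
  (1 - 20 * e ^+ 2) * diag_kernel y t + e * (y ^+ 3 * first_moments y t) <=
  diag_kernel (y * (1 + e)) t.
Proof.
move=> y0 e0 e5; have y1 : y != 0 by rewrite gt_eqF.
have Ny1 : - y != 0 by rewrite oppr_eq0.
have r01 z : 0 <= y ^+ 2 / (z ^+ 2 + y ^+ 2) <= 1.
  have d0 := sqrDsqr_gt0 z y1; have z0 := sqr_ge0 z; have yy := sqr_ge0 y.
  apply/andP; split; first by rewrite divr_ge0// ltW.
  by rewrite ler_pdivrMr//; lra.
have K0 := ltW (diag_kernel_gt0 t y0).
have := ler_wpM2l K0 (harnack_factor_ge e0 e5 (r01 t.1) (r01 t.2)).
rewrite /first_moments !Re_blaschke// sqrrN.
set x := _ / (t.1 ^+ 2 + _); set x' := _ / (t.2 ^+ 2 + _) => h.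
have -> : diag_kernel (y * (1 + e)) t = diag_kernel y t * ((1 + e) ^+ 3 /
    ((1 + (2 * e + e ^+ 2) * x) * (1 + (2 * e + e ^+ 2) * x'))).
  have d1 := sqrDsqr_gt0 t.1 y1; have d2 := sqrDsqr_gt0 t.2 y1.
  have shift z : 0 < z ^+ 2 + y ^+ 2 -> z ^+ 2 + (y * (1 + e)) ^+ 2 =
     (z ^+ 2 + y ^+ 2) * (1 + (2 * e + e ^+ 2) * (y ^+ 2 / (z ^+ 2 + y ^+ 2))).
    by move=> z0; field; rewrite gt_eqF.
  rewrite /diag_kernel /weight !shift// -/x -/x' exprMn.
  rewrite (mulrACA (t.1 ^+ 2 + _)) (invfM (_ * _)); ring.
apply: le_trans h; rewrite /diag_kernel le_eqVlt; apply/orP; left.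
by apply/eqP; ring.
Qed.

Lemma diag_step y e : 0 < y -> 0 <= e -> e <= 1 / 5 ->
  (1 - 20 * e ^+ 2) * diag y <= diag (y * (1 + e)).
Proof.
move=> y0 e0 e5; have y1 : y != 0 by rewrite gt_eqF.
have ye : y * (1 + e) != 0 by rewrite mulf_neq0//; lra.
have iq := integrable_first_moments mu_nevanlinna y1.
have iK := integrable_diag_kernel y1.
have i3 := integrableZl_fun e (integrableZl_fun (y ^+ 3) iq).
have i2 := integrableZl_fun (1 - 20 * e ^+ 2) iK.
have := le_Rintegral measurableT (integrableD_fun i2 i3)
  (integrable_diag_kernel ye) (fun t _ => diag_kernel_step t y0 e0 e5).
apply: le_trans; rewrite RintegralD//.
rewrite (RintegralZl _ measurableT iK).
rewrite (RintegralZl _ measurableT (integrableZl_fun (y ^+ 3) iq)).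
rewrite (RintegralZl _ measurableT iq) lerDl !mulr_ge0 ?exprn_ge0 ?(ltW y0)//.
exact: integral_first_moments_ge0.
Qed.

(** A positive kernel with zero integral forces the whole plane to be null. *)
Lemma diag_gt0 y : 0 < y -> nontrivial_measure mu -> 0 < diag y.
Proof.
move=> y0 [A mA muA]; have y1 : y != 0 by rewrite gt_eqF.
have iK := integrable_diag_kernel y1.
rewrite lt_neqAle Rintegral_ge0 ?andbT => [|t _]; last exact: ltW (diag_kernel_gt0 t y0).
apply/eqP => K0; apply: muA; apply/eqP; rewrite eq_le measure_ge0 andbT.
have [mK _] := integrableP _ _ _ iK.
have E0 : (\int[mu]_(t in setT) `|(EFin \o diag_kernel y) t|)%E = 0%E.
  under eq_integral do rewrite gee0_abs ?lee_fin ?(ltW (diag_kernel_gt0 _ y0))//.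
  rewrite -(fineK (integrable_fin_num measurableT iK)).
  by congr EFin; rewrite [RHS]K0.
have := (ae_eq_integral_abs mu measurableT mK).1 E0.
move=> [N [mN N0 sN]]; rewrite -N0; apply: le_measure; rewrite ?inE// => t At.
apply: sN => /= /(_ I) [] /eqP; rewrite gt_eqF//; exact: diag_kernel_gt0.
Qed.

(** The recursion [diag_step] is compared with the sequence [1 + 40 / n], which
    is bounded below and decreases fast enough:
    [1 + 40 / (n + 1) <= (1 - 20 / n^2) (1 + 40 / n)] for [n >= 50]. *)
Lemma diag_lower_bound : nontrivial_measure mu ->
  exists2 c : R, 0 < c & forall n : nat, (50 <= n)%N -> c <= diag n%:R.
Proof.
move=> mu0; have g0 : 0 < diag 50 by apply: diag_gt0.
exists (diag 50 / 2); first by rewrite divr_gt0.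
move=> n n50.
suff : diag 50 / 2 * (1 + 40 / n%:R) <= diag n%:R.
  apply: le_trans; rewrite ler_peMr ?lerDl ?divr_ge0//; exact: ltW.
elim: n n50 => [//|n IH]; rewrite leq_eqVlt => /predU1P[<-|n50].
  by rewrite (_ : 1 + 40 / 50 = 9 / 5 :> R); [lra|field].
have {}IH := IH n50.
have x50 : (50 : R) <= n%:R by rewrite (ler_nat R 50).
have -> : n.+1%:R = n%:R * (1 + n%:R^-1) :> R.
  by rewrite mulrDr mulr1 mulfV ?natr1// gt_eqF//; lra.
have e5 : n%:R^-1 <= (1 / 5 : R).
  by rewrite -div1r ler_pdivrMr; lra.
have e0 : 0 <= n%:R^-1 :> R by rewrite invr_ge0.
apply: le_trans (diag_step _ e0 e5); last by lra.
have h : 0 <= 1 - 20 * (n%:R^-1 : R) ^+ 2 by nra.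
apply: le_trans (ler_wpM2l h IH).
rewrite mulrCA ler_pM2l ?divr_gt0//.
have x0 : (0 : R) < n%:R by lra.
have e50 : n%:R^-1 <= (1 / 50 : R) by rewrite -div1r ler_pdivrMr//; lra.
rewrite invfM; move: n%:R^-1 e0 e50 => e e0 e50.
have -> : 40 * (e * (1 + e)^-1) = 40 * e / (1 + e) by rewrite mulrA.
rewrite -lerBrDl ler_pdivrMr; last lra.
rewrite -subr_ge0 (_ : _ - _ = e ^+ 2 * (20 - 820 * e - 800 * e ^+ 2)); last by ring.
apply: mulr_ge0; first exact: sqr_ge0.
have : e ^+ 2 <= (1 / 50) ^+ 2 by rewrite ler_sqr ?nnegrE.
by lra.
Qed.

End growth_of_diagonal.

(** * Dyadic upper bound and conclusion *)

Section dyadic_upper_bound.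
Context {R : realType}.
Variable mu : {measure set (R * R)%type -> \bar R}.

Lemma measurable_centered_square (r : R) :
  measurable (centered_square r : set (R * R)).
Proof.
have -> : centered_square r = [set` `]- r, r[] `*` [set` `]- r, r[] :> set (R * R).
  by apply/seteqP; split => t /=; rewrite /centered_square /= !in_itv /= -!ltr_norml.
exact: measurableX.
Qed.

Lemma diag_kernel_le (y r : R) (t : R * R) : 0 < y -> 0 <= r ->
  (r <= `|t.1|) || (r <= `|t.2|) -> diag_kernel y t <= y / (r ^+ 2 + y ^+ 2).
Proof.
move=> y0 r0 rt; have y2 : 0 < y ^+ 2 by rewrite exprn_gt0.
have a0 := sqr_ge0 t.1; have b0 := sqr_ge0 t.2; have rr := sqr_ge0 r.
have le z : r <= `|z| -> r ^+ 2 <= z ^+ 2.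
  by move=> rz; rewrite -(real_normK (num_real z)) ler_sqr ?nnegrE.
rewrite /diag_kernel /weight exprS -mulrA ler_pM2l//.
rewrite ler_pdivrMr ?mulr_gt0 ?ltr_wpDl// mulrC ler_pdivlMr ?ltr_wpDl//.
case/orP: rt => /le h.
- rewrite (mulrC (t.1 ^+ 2 + _)).
  by apply: ler_pM; rewrite ?lerD2r ?lerDr ?addr_ge0// ltW.
- by apply: ler_pM; rewrite ?lerD2r ?lerDr ?addr_ge0// ltW.
Qed.

(** The kernel is dominated by the series of [4 / (4^k y)] times the indicator of
    the square of half-side [2^k y]; the [k]-th term then contributes at most
    [4 eps / 2^k]. *)
Lemma integral_diag_kernel_le (y eps : R) : 0 < y -> 0 <= eps ->
  (forall r : R, (y <= r)%R -> mu (centered_square r) <= (eps * r)%:E)%E ->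
  (\int[mu]_(t in setT) (diag_kernel y t)%:E <= (8 * eps)%:E)%E.
Proof.
move=> y0 e0 hmu.
pose f k (t : R * R) : \bar R :=
  ((4 / (4 ^+ k * y))%:E * (\1_(centered_square (2 ^+ k * y)) t)%:E)%E.
have c0 k : 0 <= 4 / (4 ^+ k * y) by rewrite divr_ge0// mulr_ge0 ?exprn_ge0// ltW.
have f0 k t : (0 <= f k t)%E by rewrite mule_ge0 ?lee_fin.
have mf k : measurable_fun setT (f k).
  apply: measurable_funeM; apply/measurable_EFinP.
  exact: measurable_indic (measurable_centered_square _).
apply: (@le_trans _ _ (\int[mu]_(t in setT) \sum_(0 <= k <oo) f k t)%E).
  apply: ge0_le_integral => //.
  - by move=> t _; rewrite lee_fin ltW// diag_kernel_gt0.
  - by apply/measurable_EFinP; apply: measurable_funM; [exact: measurable_cst|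
      apply: measurable_weight; rewrite gt_eqF].
  - by apply: ge0_emeasurable_sum.
  - move=> t _.
    have ex : exists k, (`|t.1| < 2 ^+ k * y) && (`|t.2| < 2 ^+ k * y).
      pose m := Num.max `|t.1| `|t.2|.
      have m0 : 0 <= m / y by rewrite divr_ge0 ?le_max ?normr_ge0// ltW.
      exists (Num.bound (m / y)); rewrite -gt_max -/m -ltr_pdivrMr//.
      apply: lt_trans (archi_boundP m0) _.
      by rewrite -natrX ltr_nat ltn_expl.
    (* The first square containing t already gives the bound. *)
    case: (ex_minnP ex) => k /andP[k1 k2] kmin.
    apply: (@le_trans _ _ (f k t)); last first.
      apply: le_trans (nneseries_lim_ge k.+1 (fun i _ _ => f0 i t)).
      by rewrite big_nat_recr//= leeDr// sume_ge0.
    rewrite /f indicE mem_set//= mule1 lee_fin.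
    case: k => [|k] in k1 k2 kmin *.
      have := @diag_kernel_le y 0 t y0 (lexx 0).
      rewrite normr_ge0 => /(_ isT)/le_trans; apply.
      rewrite expr0n add0r expr0 mul1r expr2 invfM mulrA mulfV ?gt_eqF// mul1r.
      by rewrite ler_peMl ?invr_ge0// ?(ltW y0)// ler1n.
    have rk : 0 <= 2 ^+ k * y by rewrite mulr_ge0 ?exprn_ge0// ltW.
    have rt : (2 ^+ k * y <= `|t.1|) || (2 ^+ k * y <= `|t.2|).
      rewrite !leNgt -negb_and; apply/negP => /kmin; by rewrite ltnn.
    apply: le_trans (diag_kernel_le y0 rk rt) _.
    have y2 : 0 < y ^+ 2 by rewrite exprn_gt0.
    have p0 : 0 < (4 : R) ^+ k by rewrite exprn_gt0.
    have e4 : (2 ^+ k) ^+ 2 = 4 ^+ k :> R by rewrite -exprM mulnC exprM -natrX.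
    rewrite exprMn e4 (exprS 4 k).
    have -> : 4 / (4 * 4 ^+ k * y) = y / (4 ^+ k * y ^+ 2).
      by field; rewrite !gt_eqF.
    rewrite ler_pM2l// lef_pV2 ?posrE ?addr_gt0 ?mulr_gt0// lerDl ltW//.
rewrite integral_nneseries//.
apply: (@le_trans _ _ (\sum_(0 <= k <oo) (8 * eps / (2 ^ k.+1)%:R)%:E)%E); last first.
  by apply: epsilon_trick0; rewrite mulr_ge0.
apply: lee_nneseries => [k _ _|k _]; first exact: integral_ge0.
rewrite ge0_integralZl ?lee_fin ?c0//; last first.
  by apply/measurable_EFinP; exact: measurable_indic (measurable_centered_square _).
rewrite integral_indic ?setIT//; last exact: measurable_centered_square.
have yk : y <= 2 ^+ k * y by rewrite ler_peMl ?(ltW y0)// exprn_ege1// ler1n.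
apply: le_trans (lee_wpmul2l _ (hmu _ yk)) _; first by rewrite lee_fin c0.
rewrite -EFinM lee_fin natrX (exprS 2 k).
have -> : (4 : R) ^+ k = 2 ^+ k * 2 ^+ k.
  by rewrite -exprMn -natrM.
have p0 : (0 : R) < 2 ^+ k by rewrite exprn_gt0.
rewrite le_eqVlt; apply/orP; left; apply/eqP; field.
by rewrite !gt_eqF.
Qed.

End dyadic_upper_bound.

Theorem proposition5p3 (R : realType)
    (mu : {measure set (R * R)%type -> \bar R})
    (mu_nevanlinna : Nevanlinna_measure mu)
    (mu_nontrivial : nontrivial_measure mu) :
  (0 < limf_esup (fun r : R => (r^-1)%:E * mu (centered_square r))
         (pinfty_nbhs R))%E.
Proof.
have [c c0 hc] := diag_lower_bound mu_nevanlinna mu_nontrivial.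
(* Otherwise mu (D (0, r)) <= (c / 16) r for all large r, hence diag n <= c / 2
   for large n. *)
rewrite ltNge; apply/negP => sup0.
have /ereal_inf_lt[_ [V [M [_ MV]] <-]] : (limf_esup (fun r : R =>
    (r^-1)%:E * mu (centered_square r)) (pinfty_nbhs R) < (c / 16)%:E)%E.
  by apply: le_lt_trans sup0 _; rewrite lte_fin divr_gt0.
move=> supV.
pose n := (maxn 50 (Num.bound (`|M|))).+1.
have n50 : (50 <= n)%N by rewrite leqW ?leq_maxl.
have nM : M < n%:R.
  apply: le_lt_trans (ler_norm M) _; apply: lt_le_trans (archi_boundP (normr_ge0 M)) _.
  by rewrite ler_nat leqW ?leq_maxr.
have n0 : (0 : R) < n%:R by rewrite ltr0n.
have := @integral_diag_kernel_le R mu n%:R (c / 16) n0.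
rewrite divr_ge0// ?(ltW c0)// => /(_ erefl) H.
have {}H : (\int[mu]_(t in setT) (diag_kernel n%:R t)%:E <= (8 * (c / 16))%:E)%E.
  apply: H => r nr; have r0 : 0 < r by exact: lt_le_trans nr.
  have : ((r^-1)%:E * mu (centered_square r) <= (c / 16)%:E)%E.
    apply: ltW; apply: le_lt_trans supV; apply: ereal_sup_ubound.
    by exists r => //; apply: MV; exact: lt_le_trans nr.
  by rewrite lee_pdivrMl// muleC -EFinM mulrC.
have iK := integrable_diag_kernel mu_nevanlinna (lt0r_neq0 n0).
move: H; rewrite -(fineK (integrable_fin_num measurableT iK)) lee_fin.
by move=> /(le_trans (hc n n50)); lra.
Qed.
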